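(* Let $r\ge 2$ be an integer. Then for all integers $n\ge 2$, $$R_{1/r}(n)\ \ge\ \left[e^{-1}\left(1+\frac1r\right)+o_r(1)\right]\, n\left(1+\frac1r\right)^{n/2},$$ where $o_r(1)$ denotes a quantity depending on $r$ and $n$ that, for each fixed $r$, tends to $0$ as $n\to\infty$.
   Context: For integers $r\ge1$, $n\ge 2$, the $n$-th $1/r$-Ramsey number $R_{1/r}(n)$ is the least $N$ such that every colouring of the edges of the complete graph $K_N$ with $r+1$ colours admits a copy of $K_n$ in $K_N$ whose edges use at most $r$ of the colours. Here $e$ is Euler's number. *)

(* Defs.v *)
From mathcomp Require Import all_boot.

Set Implicit Arguments.
Unset Strict Implicit.
Unset Printing Implicit Defensive.

Definition edge (N : nat) := {e : {set 'I_N} | #|e| == 2}.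

Definition colours_on (r N : nat) (c : {ffun edge N -> 'I_r.+1})
    (A : {set 'I_N}) : {set 'I_r.+1} :=
  [set c e | e : edge N & val e \subset A].

Definition arrows (r n N : nat) : bool :=
  [forall c : {ffun edge N -> 'I_r.+1},
     exists A : {set 'I_N}, (#|A| == n) && (#|colours_on c A| <= r)].

Lemma two_colour_ramsey (s t : nat) : exists N : nat,
  forall (T : finType) (e : rel T) (V : {set T}), symmetric e -> N <= #|V| ->
  (exists A : {set T}, [/\ A \subset V, #|A| = s &
     {in A &, forall x y, x != y -> e x y}]) \/
  (exists A : {set T}, [/\ A \subset V, #|A| = t &
     {in A &, forall x y, x != y -> ~~ e x y}]).
Proof.
elim: s t => [|s IHs] t.
  exists 0 => T e V _ _; left; exists set0.
  by split; rewrite ?sub0set ?cards0 // => x y; rewrite inE.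
elim: t => [|t [N2 IHt]].
  exists 0 => T e V _ _; right; exists set0.
  by split; rewrite ?sub0set ?cards0 // => x y; rewrite inE.
have [N1 {}IHs] := IHs t.+1.
exists (N1 + N2).+1 => T e V eC leNV.
have /card_gt0P[x xV] : 0 < #|V| by apply: leq_trans leNV.
have ext (f : rel T) (A W : {set T}) : symmetric f -> W \subset V ->
    A \subset W -> (forall y, y \in W -> (y != x) && f x y) ->
    {in A &, forall y z, y != z -> f y z} ->
    [/\ x |: A \subset V, #|x |: A| = #|A|.+1 &
        {in x |: A &, forall y z, y != z -> f y z}].
  move=> fC WV AW Wx Af; have Ax y : y \in A -> (y != x) && f x y.
    by move=> yA; apply/Wx/(subsetP AW).
  split.
  - by rewrite subUset sub1set xV (subset_trans AW WV).
  - by rewrite cardsU1; case: (boolP (x \in A)) => [/Ax|//]; rewrite eqxx.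
  move=> y z /setU1P[-> | yA] /setU1P[-> | zA]; rewrite ?eqxx //.
  - by case/andP: (Ax _ zA).
  - by case/andP: (Ax _ yA); rewrite fC.
  - exact: Af.
pose V1 := [set y in V :\ x | e x y]; pose V2 := [set y in V :\ x | ~~ e x y].
have V1V : V1 \subset V by apply/subsetP => y; rewrite !inE => /andP[/andP[]].
have V2V : V2 \subset V by apply/subsetP => y; rewrite !inE => /andP[/andP[]].
have V1x y : y \in V1 -> (y != x) && e x y.
  by rewrite !inE => /andP[/andP[-> _] ->].
have V2x y : y \in V2 -> (y != x) && ~~ e x y.
  by rewrite !inE => /andP[/andP[-> _] ->].
have neC : symmetric (fun y z => ~~ e y z) by move=> y z; rewrite eC.
have : N1 + N2 <= #|V1| + #|V2|.
  move: leNV; rewrite (cardsD1 x V) xV ltnS => /leq_trans; apply.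
  rewrite (leq_trans _ (leq_card_setU _ _)) //; apply/subset_leq_card/subsetP.
  by move=> y; rewrite !inE => ->; case: (e x y).
have [N1V _|V1N leNV'] := leqP N1 #|V1|.
  have [[A [AW <- Af]] | [A [AW At Af]]] := IHs T e V1 eC N1V.
    by left; exists (x |: A); apply: (ext e A V1).
  by right; exists A; split=> //; apply: subset_trans AW V1V.
have N2V : N2 <= #|V2|.
  rewrite leqNgt; apply: contraL leNV' => ?.
  by rewrite -ltnNge -addnS leq_add // ltnW.
have [[A [AW As Af]] | [A [AW <- Af]]] := IHt T e V2 eC N2V.
  by left; exists A; split=> //; apply: subset_trans AW V2V.
by right; exists (x |: A); apply: (ext (fun y z => ~~ e y z) A V2).
Qed.

Lemma ex_arrows (r n : nat) : 0 < r -> exists N, arrows r n N.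
Proof.
move=> r_gt0; have [N RN] := two_colour_ramsey n n; exists N.
apply/forallP => c.
pose f (x y : 'I_N) :=
    oapp (fun e : edge N => c e == ord0) false (insub [set x; y]).
have fC : symmetric f by move=> x y; rewrite /f setUC.
have fE (u : edge N) : exists x y,
    [/\ x != y, val u = [set x; y] & f x y = (c u == ord0)].
  have /cards2P[x [y [xy uE]]] : #|val u| == 2 by exact: (valP u).
  exists x, y; split=> //.
  by rewrite /f -uE valK.
have [|[A [_ An Af]]|[A [_ An Af]]] := RN _ f setT fC.
- by rewrite cardsT card_ord.
- apply/existsP; exists A; rewrite An eqxx /=.
  apply: leq_trans r_gt0; rewrite -(cards1 (ord0 : 'I_r.+1)).
  apply/subset_leq_card/subsetP => _ /imsetP[u + ->]; rewrite !inE.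
  have [x [y [xy -> <-]]] := fE u; rewrite subUset !sub1set => /andP[xA yA].
  exact: Af.
- apply/existsP; exists A; rewrite An eqxx /=.
  have rE : #|[set~ (ord0 : 'I_r.+1)]| = r by rewrite cardsC1 card_ord.
  rewrite -[leqRHS]rE; apply/subset_leq_card/subsetP => _ /imsetP[u + ->]; rewrite !inE.
  have [x [y [xy -> <-]]] := fE u; rewrite subUset !sub1set => /andP[xA yA].
  exact: Af.
Qed.

(* With r = 0 no number N works as soon as n >= 2, whence the hypothesis on r. *)
Definition ramsey_number (r n : nat) (r_gt0 : 0 < r) : nat :=
  ex_minn (ex_arrows n r_gt0).

(* Main.v *)
Require Import Defs.
From mathcomp Require Import all_boot all_order all_algebra.
From mathcomp Require Import all_classical all_reals all_analysis.
From mathcomp Require Import zify ring lra.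
Import Order.TTheory GRing.Theory Num.Theory numFieldNormedType.Exports.

(* Colour the edges independently with probabilities that are close to
   1 / (r + 1) but correlated through hidden signs of the vertices, so that
   monochromatic triangles of every colour are slightly more likely than for a
   uniform colouring.  This makes it less likely that an n-set misses a colour,
   and the plain first moment method then beats the claimed bound.

   In detail, each pair e carries a vector X_e indexed by the colours, initially
   0, and the probability of colour i is (1 + W_i) / (r + 1) for
   W_i = (r + 1) X_e(i) - sum X_e.  At a step aimed at colour j, every vertex u
   draws a sign x_u, and X_{uv}(j) moves by eta x_u x_v, unless X_{uv} has already
   left a small box.  The conditional probability that A misses i is
   (r / (r + 1)) ^ binom(n, 2) times Z = prod (1 - W_i / r), and a step multiplies
   the expectation of Z by exp (- sum over triangles of t t t + lower order), where
   t = eta for a step aimed at i and t = - eta / r otherwise.  The r other colours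
   thus lose a fraction r * r^-3 of what colour i gains, which is less than 1 as
   soon as r >= 2.  With eta of order n^-2 and n^4 steps the total gain is
   exp (- C n) with C as large as we please, unless many pairs of A have left the
   box; the latter has probability exp (- n^2), by an exponential moment of
   sum X_e^2. *)

Set Implicit Arguments.
Unset Strict Implicit.
Unset Printing Implicit Defensive.

Local Open Scope ring_scope.

(** * Exponential inequalities *)

Lemma le_of_derive_le0 (R : realType) (f df : R -> R) (x : R) :
  (forall y : R, is_derive y (1 : R) f (df y)) ->
  (forall y, 0 <= y <= x -> df y <= 0) -> 0 <= x -> f x <= f 0.
Proof.
move=> fd df0 x0.
have cf : ({within `[0, x], continuous f})%classic.
  by apply: derivable_within_continuous => y _; exact: ex_derive.
apply: (@ler0_derive1_le_cc R f 0 x) => //.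
- move=> y; rewrite in_itv /= => /andP[y0 yx].
  by rewrite derive1E (@derive_val _ _ _ _ _ _ _ (fd y)) df0 // !ltW.
- by rewrite in_itv /= lexx x0.
- by rewrite in_itv /= lexx x0.
Qed.

(** This gives the sign of the derivative in [expR_cosh_le]. Left minus right side is nonincreasing
    for [h >= 0], because [1 - 2x <= exp (- 2x)]. *)
Lemma one_sub_mul_expR_le (R : realType) (h : R) :
  0 <= h -> (1 - h) * expR (h *+ 2) <= 1 + h.
Proof.
move=> h0.
pose f (x : R) := (1 - x) * expR (x *+ 2) - (1 + x).
suff : f h <= f 0 by rewrite /f mul0rn expR0; lra.
apply: (@le_of_derive_le0 R f (fun x => (1 - x *+ 2) * expR (x *+ 2) - 1)) => //.
  move=> y; apply: is_derive_eq.
  rewrite /GRing.scale /=; ring.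
move=> y /andP[y0 _].
have := expR_ge1Dx (- (y *+ 2)).
rewrite expRN => H; have e0 := expR_gt0 (y *+ 2).
by rewrite subr_le0 -ler_pdivlMr ?div1r.
Qed.

Lemma expR_cosh_le (R : realType) (h : R) :
  expR h + expR (- h) <= 2 * expR (h ^+ 2 / 2).
Proof.
wlog h0 : h / 0 <= h.
  move=> H; case: (leP 0 h) => [/H//|h0].
  have H1 : 0 <= - h by rewrite oppr_ge0 ltW.
  by move: (H _ H1); rewrite opprK sqrrN addrC.
pose f (x : R) := expR (x - x ^+ 2 / 2) + expR (- x - x ^+ 2 / 2).
have : f h <= f 0.
  apply: (@le_of_derive_le0 R f (fun x => (1 - x) * expR (x - x ^+ 2 / 2)
     - (1 + x) * expR (- x - x ^+ 2 / 2))) => //.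
    move=> y; apply: is_derive_eq.
    by rewrite /GRing.scale /=; field.
  move=> y /andP[y0 _].
  have -> : y - y ^+ 2 / 2 = y *+ 2 + (- y - y ^+ 2 / 2) by lra.
  by rewrite expRD mulrA -mulrBl mulr_le0_ge0 ?expR_ge0 // subr_le0 one_sub_mul_expR_le.
have -> : f 0 = 2 by rewrite /f expr0n /= mul0r oppr0 addr0 expR0.
by rewrite /f !expRB -mulrDl ler_pdivrMr ?expR_gt0.
Qed.

(** A Taylor bound for [log (1 - u)]. The quadratic term is kept exactly, since [mean_pairprod_le]
    has to cancel it against the variance of the signs. *)
Lemma one_sub_le_expR (R : realType) (u : R) : `|u| <= 2^-1 ->
  1 - u <= expR (- u - u ^+ 2 / 2 + `|u| ^+ 3).
Proof.
(* Here [d] is the sign of [u] and [v] its absolute value, so that monotonicity is only used on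
   nonnegative arguments. *)
have key (v : R) (d : R) : 0 <= v -> v <= 1 -> d = 1 \/ d = -1 ->
    1 - d * v <= expR (- (d * v) - (d * v) ^+ 2 / 2 + v ^+ 3).
  move=> v0 v1 d1.
  pose f (x : R) := (1 - d * x) * expR (d * x + (d * x) ^+ 2 / 2 - x ^+ 3).
  have : f v <= f 0.
    apply: (@le_of_derive_le0 R f (fun x => (- d + (1 - d * x) * (d + d ^+ 2 * x - 3 * x ^+ 2))
       * expR (d * x + (d * x) ^+ 2 / 2 - x ^+ 3))) => //.
      move=> y; apply: is_derive_eq.
      by rewrite /GRing.scale /=; field.
    move=> y /andP[y0 yv]; apply: mulr_le0_ge0; last exact: expR_ge0.
    have y1 := le_trans yv v1.
    by case: d1 => ->; nra.
  have -> : - (d * v) - (d * v) ^+ 2 / 2 + v ^+ 3 = - (d * v + (d * v) ^+ 2 / 2 - v ^+ 3) by ring.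
  rewrite /f !mulr0 !expr0n /= mul0r !subr0 addr0 expR0 mulr1 expRN.
  by move=> fv; rewrite -[leRHS]div1r ler_pdivlMr ?expR_gt0.
move=> u1; have u1' : `|u| <= 1 by lra.
case: (leP 0 u) => u0.
  by have := key `|u| 1 (normr_ge0 _) u1' (or_introl erefl); rewrite ger0_norm // !mul1r.
have := key `|u| (-1) (normr_ge0 _) u1' (or_intror erefl).
by rewrite (ltr0_norm u0) !mulN1r !opprK.
Qed.

(** * Sums over pairs and triples *)

Section Mean.
Variables (R : realType) (I : finType).
Implicit Types F G : I -> R.

Definition mean F : R := (\sum_i F i) / #|I|%:R.

Lemma mean_le F G : (forall i, F i <= G i) -> mean F <= mean G.
Proof. by move=> FG; rewrite ler_wpM2r ?invr_ge0 ?ler0n // ler_sum. Qed.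

Lemma meanZ (c : R) F : mean (fun i => c * F i) = c * mean F.
Proof. by rewrite /mean -mulr_sumr mulrA. Qed.

Lemma meanD F G : mean (fun i => F i + G i) = mean F + mean G.
Proof. by rewrite /mean big_split mulrDl. Qed.

Lemma mean_sum (K : finType) (P : pred K) (F : K -> I -> R) :
  mean (fun i => \sum_(k | P k) F k i) = \sum_(k | P k) mean (F k).
Proof. by rewrite /mean exchange_big mulr_suml. Qed.

Lemma mean_cst (c : R) : (0 < #|I|)%N -> mean (fun=> c) = c.
Proof.
move=> I0; rewrite /mean sumr_const -[c *+ _]mulr_natr mulfK //.
by rewrite pnatr_eq0 -lt0n.
Qed.

Lemma mean_ge_ex F : (0 < #|I|)%N -> exists i, F i <= mean F.
Proof.
move=> I0; apply/not_existsP => H.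
have I0' : 0 < #|I|%:R :> R by rewrite ltr0n.
have /card_gt0P[i0 _] := I0.
have : mean F * #|I|%:R < \sum_i F i.
  rewrite mulr_natr -sumr_const; apply: ltr_sum; first by apply/hasP; exists i0; rewrite ?mem_index_enum.
  by move=> i _; rewrite ltNge; apply/negP/H.
by rewrite /mean divfK ?ltxx // gt_eqF.
Qed.

End Mean.

Section PairSums.
Variables (R : realType) (T : Type).
Implicit Types (f g : T -> T -> R) (h k : T -> T -> T -> R) (s : seq T).

(** Recursion along the list lets an induction remove one vertex at a time. *)
Fixpoint pairsum f s : R :=
  if s is v :: s' then \sum_(u <- s') f v u + pairsum f s' else 0.

Fixpoint pairprod f s : R :=
  if s is v :: s' then \prod_(u <- s') f v u * pairprod f s' else 1.

Fixpoint trisum h s : R :=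
  if s is v :: s' then pairsum (h v) s' + trisum h s' else 0.

Lemma eq_pairsum f g s : (forall u v, f u v = g u v) -> pairsum f s = pairsum g s.
Proof. by move=> fg; elim: s => //= v s ->; congr (_ + _); apply: eq_bigr. Qed.

Lemma pairsum_le f g s : (forall u v, f u v <= g u v) -> pairsum f s <= pairsum g s.
Proof. by move=> fg; elim: s => //= v s IH; rewrite lerD // ler_sum. Qed.

Lemma pairsumD f g s : pairsum (fun u v => f u v + g u v) s = pairsum f s + pairsum g s.
Proof. by elim: s => [|v s /= ->]; rewrite ?addr0 // big_split /= addrACA. Qed.

Lemma pairsumZ (c : R) f s : pairsum (fun u v => c * f u v) s = c * pairsum f s.
Proof. by elim: s => [|v s /= ->]; rewrite ?mulr0 // -mulr_sumr mulrDr. Qed.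

Lemma pairsum_cst_le (c : R) s : 0 <= c ->
  pairsum (fun _ _ => c) s <= (size s)%:R ^+ 2 / 2 * c.
Proof.
move=> c0; elim: s => [|v s IH] /=; first by rewrite expr0n /= !mul0r.
rewrite big_const_seq count_predT iter_addr_0 -mulr_natr -[(size s).+1%:R]natr1.
apply: (le_trans (lerD (lexx _) IH)); set n := (size s)%:R.
by have : 0 <= n * c by [rewrite mulr_ge0]; nra.
Qed.

Lemma pairsum_le_cst f (c : R) s : 0 <= c -> (forall u v, f u v <= c) ->
  pairsum f s <= (size s)%:R ^+ 2 / 2 * c.
Proof.
by move=> c0 fc; apply: le_trans (pairsum_cst_le _ c0); exact: pairsum_le.
Qed.

Lemma trisum_le h k s : (forall u v w, h u v w <= k u v w) -> trisum h s <= trisum k s.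
Proof. by move=> hk; elim: s => //= v s IH; rewrite lerD // pairsum_le. Qed.

Lemma eq_trisum h k s : (forall u v w, h u v w = k u v w) -> trisum h s = trisum k s.
Proof. by move=> hk; elim: s => //= v s ->; congr (_ + _); apply: eq_pairsum. Qed.

Lemma trisumD h k s :
  trisum (fun u v w => h u v w + k u v w) s = trisum h s + trisum k s.
Proof. by elim: s => [|v s /= ->]; rewrite ?addr0 // pairsumD /= addrACA. Qed.

Lemma trisumZ (c : R) h s :
  trisum (fun u v w => c * h u v w) s = c * trisum h s.
Proof. by elim: s => [|v s /= ->]; rewrite ?mulr0 // pairsumZ mulrDr. Qed.

Lemma pairsum1 s : pairsum (fun _ _ => 1) s = 'C(size s, 2)%:R.
Proof.
elim: s => [|v s /= ->]; first by rewrite bin0n.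
by rewrite big_const_seq count_predT iter_addr_0 -natrD binS bin1 addnC.
Qed.

Lemma trisum1 s : trisum (fun _ _ _ => 1) s = 'C(size s, 3)%:R.
Proof.
elim: s => [|v s /= ->]; first by rewrite bin0n.
by rewrite pairsum1 -natrD binS addnC.
Qed.

Lemma trisum_le_cst h (c : R) s : 0 <= c -> (forall u v w, h u v w <= c) ->
  trisum h s <= (size s)%:R ^+ 3 / 6 * c.
Proof.
move=> c0 hc; apply: (@le_trans _ _ (trisum (fun _ _ _ => c) s)); first exact: trisum_le.
elim: s => [|v s IH] /=; first by rewrite expr0n /= !mul0r.
apply: (le_trans (lerD (pairsum_cst_le s c0) IH)); rewrite -[(size s).+1%:R]natr1; set n := (size s)%:R.
by have : 0 <= n * c by [rewrite mulr_ge0]; nra.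
Qed.

Lemma pairsum_sumD_le (f : T -> R) s : (forall u, 0 <= f u) ->
  pairsum (fun u v => f u + f v) s <= (size s)%:R * \sum_(u <- s) f u.
Proof.
move=> f0; elim: s => [|v s IH] /=; first by rewrite mul0r.
rewrite big_split big_cons /= big_const_seq count_predT iter_addr_0 -[(size s).+1%:R]natr1 -mulr_natl.
have S0 : 0 <= \sum_(u <- s) f u by apply: sumr_ge0.
have := f0 v; lra.
Qed.

(** Double counting: each pair of positions lies in at most [size s] triples. *)
Lemma trisum_pairs_le f s : (forall u v, 0 <= f u v) ->
  trisum (fun u v w => f u v + f u w + f v w) s <= (size s)%:R * pairsum f s.
Proof.
move=> f0; elim: s => [|v s IH] /=; first by rewrite mul0r.
rewrite pairsumD -[(size s).+1%:R]natr1.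
have := @pairsum_sumD_le (f v) s (f0 v).
have P0 : 0 <= pairsum f s.
  elim: (s) => [|u s' IH'] //=; rewrite addr_ge0 // sumr_ge0 //.
have S0 : 0 <= \sum_(u <- s) f v u by apply: sumr_ge0.
move: IH; lra.
Qed.

Lemma pairprodM f g s :
  pairprod (fun u v => f u v * g u v) s = pairprod f s * pairprod g s.
Proof. by elim: s => [|v s /= ->]; rewrite ?mulr1 // big_split /= mulrACA. Qed.

Lemma pairprod_ge0 f s : (forall u v, 0 <= f u v) -> 0 <= pairprod f s.
Proof.
by move=> f0; elim: s => [|v s IH] /=; rewrite ?ler01 // mulr_ge0 // prodr_ge0.
Qed.

Lemma pairprod_le_expR f g s : (forall u v, 0 <= f u v <= expR (g u v)) ->
  pairprod f s <= expR (pairsum g s).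
Proof.
move=> fg; elim: s => [|v s IH] /=; first by rewrite expR0.
rewrite expRD expR_sum ler_pM ?prodr_ge0 ?pairprod_ge0 //.
- by move=> u _; case/andP: (fg v u).
- by move=> u w; case/andP: (fg u w).
- by apply: ler_prod => u _; exact: fg.
Qed.

Lemma eq_pairprod f g s : (forall u v, f u v = g u v) -> pairprod f s = pairprod g s.
Proof. by move=> fg; elim: s => //= v s ->; congr (_ * _); apply: eq_bigr. Qed.

Lemma pairprod_cst (c : R) s : pairprod (fun _ _ => c) s = c ^+ 'C(size s, 2).
Proof.
elim: s => [|v s /= ->]; first by rewrite bin0n expr0.
by rewrite big_const_seq count_predT iter_mulr_1 -exprD binS bin1 addnC.
Qed.

Lemma sqr_sum_pairsum (a : T -> R) s :
  (\sum_(u <- s) a u) ^+ 2 = \sum_(u <- s) a u ^+ 2 + 2 * pairsum (fun u v => a u * a v) s.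
Proof.
elim: s => [|v s IH] /=; first by rewrite !big_nil expr0n /= mulr0 addr0.
by rewrite !big_cons sqrrD IH -mulr_sumr; ring.
Qed.

End PairSums.

(** * Quadratic forms in random signs *)

Section Signs.
Variables (R : realType) (T : finType).
Implicit Types (x : {ffun T -> bool}) (s : seq T) (y : T -> T -> R).

Definition sg x (u : T) : R := (-1) ^+ (x u).

(** An involution, so it preserves uniform averages; pairing [x] with [flip v x] integrates out the
    sign of [v]. *)
Definition flip (v : T) x : {ffun T -> bool} := [ffun u => x u (+) (u == v)].

Lemma flipK v : involutive (flip v).
Proof. by move=> x; apply/ffunP => u; rewrite !ffunE addbK. Qed.

Lemma sg_flip v x u : sg (flip v x) u = if u == v then - sg x u else sg x u.
Proof.
rewrite /sg ffunE; case: eqP => _; last by rewrite addbF.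
by rewrite addbT signrN.
Qed.

Lemma sg_sqr x u : sg x u ^+ 2 = 1.
Proof. by rewrite /sg sqrr_sign. Qed.

Lemma normr_sg x u : `|sg x u| = 1.
Proof. by rewrite /sg normr_sign. Qed.

Lemma card_signs_gt0 : (0 < #|{: {ffun T -> bool}}|)%N.
Proof. by apply/card_gt0P; exists [ffun=> true]. Qed.

Lemma mean_flip v (F : {ffun T -> bool} -> R) :
  mean F = mean (fun x => F (flip v x)).
Proof. by rewrite /mean (reindex_inj (inv_inj (flipK v))). Qed.

(* Integrating out one sign: [cosh h <= exp (h^2 / 2)]. *)
Lemma mean_expR_sg_le v (G h : {ffun T -> bool} -> R) :
  (forall x, G (flip v x) = G x) -> (forall x, h (flip v x) = h x) ->
  mean (fun x => expR (sg x v * h x + G x)) <=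
  mean (fun x => expR (h x ^+ 2 / 2 + G x)).
Proof.
move=> Gv hv; rewrite -(ler_pM2l (ltr0n _ 2)) -!meanZ.
have -> : mean (fun x => 2 * expR (sg x v * h x + G x)) =
    mean (fun x => (expR (h x) + expR (- h x)) * expR (G x)).
  rewrite meanZ mulr2n mulrDl mul1r {2}(mean_flip v) -meanD.
  congr (mean _); apply/funext => x.
  rewrite sg_flip eqxx Gv hv !expRD -mulrDl mulNr; congr (_ * _).
  by rewrite /sg; case: (x v); rewrite ?expr1 ?expr0 ?mulN1r ?mul1r ?opprK // addrC.
apply: mean_le => x; rewrite expRD mulrA ler_wpM2r ?expR_ge0 //.
exact: expR_cosh_le.
Qed.

Lemma pairsum_flip v y s : v \notin s -> forall x,
  pairsum (fun u w => y u w * (sg (flip v x) u * sg (flip v x) w)) s =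
  pairsum (fun u w => y u w * (sg x u * sg x w)) s.
Proof.
move=> vs x; elim: s vs => //= a s IH; rewrite inE negb_or => /andP[va vs].
rewrite IH //; congr (_ + _); apply: eq_big_seq => u us.
rewrite !sg_flip eq_sym (negbTE va); case: eqP => // uv.
by rewrite -uv us in vs.
Qed.

(** The sides of a triangle receive second-order corrections [p], [q], [t]. Every term of the
    expansion other than [a * b * c] contains one of them, hence is of fourth order. *)
Lemma mul3_add_le (M a b c p q t : R) : 0 <= M <= 1 ->
  `|a| <= M -> `|b| <= M -> `|c| <= M ->
  `|p| <= M ^+ 2 -> `|q| <= M ^+ 2 -> `|t| <= M ^+ 2 ->
  (a + p) * (b + q) * (c + t) <= a * b * c + 7 * M ^+ 4.
Proof.
move=> /andP[M0 M1] aM bM cM pM qM tM.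
have M2 : M ^+ 2 <= M by rewrite expr2 ler_piMr.
have M20 : 0 <= M ^+ 2 by rewrite exprn_ge0.
have bq : `|b + q| <= 2 * M by apply: le_trans (ler_normD _ _) _; lra.
have ct : `|c + t| <= 2 * M by apply: le_trans (ler_normD _ _) _; lra.
have -> : (a + p) * (b + q) * (c + t) =
  a * b * c + (p * (b + q) * (c + t) + a * q * (c + t) + a * b * t) by ring.
rewrite lerD2l.
have H1 : p * (b + q) * (c + t) <= M ^+ 2 * (2 * M) * (2 * M).
  by apply: le_trans (ler_norm _) _; rewrite !normrM !ler_pM ?mulr_ge0.
have H2 : a * q * (c + t) <= M * M ^+ 2 * (2 * M).
  by apply: le_trans (ler_norm _) _; rewrite !normrM !ler_pM ?mulr_ge0.
have H3 : a * b * t <= M * M * M ^+ 2.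
  by apply: le_trans (ler_norm _) _; rewrite !normrM !ler_pM ?mulr_ge0.
have -> : 7 * M ^+ 4 = M ^+ 2 * (2 * M) * (2 * M) + M * M ^+ 2 * (2 * M) + M * M * M ^+ 2 by ring.
by rewrite !lerD.
Qed.

(* The signs are integrated out one vertex at a time.  Removing [v] adds
   [y v u * y v w] to the coefficient of [u, w], which is where the triangle
   term comes from, and preserves the bound since
   [1 / k + 1 / k^2 <= 1 / (k - 1)]. *)
Lemma mean_expR_pairsum_shift (m : R) y s : uniq s -> 1 <= m ->
  (forall u v, `|y u v| <= (m + (size s)%:R)^-1) ->
  mean (fun x => expR (pairsum (fun u v => y u v * (sg x u * sg x v)) s)) <=
  expR (pairsum (fun u v => y u v ^+ 2 / 2) s +
        trisum (fun u v w => y u v * y u w * y v w) s +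
        (size s)%:R ^+ 4 * m^-1 ^+ 4).
Proof.
move=> + m1; elim: s y => [|v s IH] y /=.
  by rewrite mean_cst ?card_signs_gt0 // expr0n /= mul0r !addr0.
move=> /andP[vs us] ym.
set k : R := (size s)%:R; have k0 : 0 <= k by rewrite ler0n.
have mk0 : 0 < m + k by lra.
set M := m^-1; have M0 : 0 <= M by rewrite invr_ge0; lra.
have M1 : M <= 1 by rewrite invf_le1 //; lra.
have yM u w : `|y u w| <= M.
  apply: le_trans (ym u w) _; rewrite lef_pV2 ?posrE; [|lra|lra].
  by rewrite -natr1 -/k; lra.
pose p u w := y v u * y v w.
have pM u w : `|p u w| <= M ^+ 2 by rewrite /p normrM expr2 ler_pM.
pose y' u w := y u w + p u w.
have y'm u w : `|y' u w| <= (m + (size s)%:R)^-1.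
  apply: le_trans (ler_normD _ _) _; rewrite normrM -/k.
  have e : m + (size s).+1%:R = m + k + 1 by rewrite -natr1 addrA.
  set z := (m + (size s).+1%:R)^-1.
  have z0 : 0 <= z by rewrite invr_ge0 e; lra.
  apply: (@le_trans _ _ (z + z * z)); first by rewrite lerD ?ler_pM ?ym.
  have z1 : z * (m + k + 1) = 1 by rewrite /z e mulVf //; lra.
  rewrite -[leRHS]div1r ler_pdivlMr //.
  have -> : (z + z * z) * (m + k) = z * (m + k + 1) * (1 + z) - z - z * z by ring.
  by rewrite z1; nra.
have step : mean (fun x => expR (\sum_(u <- s) y v u * (sg x v * sg x u) +
      pairsum (fun u w => y u w * (sg x u * sg x w)) s)) <=
    mean (fun x => expR (\sum_(u <- s) y v u ^+ 2 / 2) *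
      expR (pairsum (fun u w => y' u w * (sg x u * sg x w)) s)).
  (* The exponent is linear in the sign of [v]: [h] is its coefficient and [G] the part free of
     [v]. *)
  pose h x := \sum_(u <- s) y v u * sg x u.
  pose G x := pairsum (fun u w => y u w * (sg x u * sg x w)) s.
  have hv x : h (flip v x) = h x.
    apply: eq_big_seq => u us'; rewrite sg_flip; case: eqP => // uv.
    by rewrite -uv us' in vs.
  have Gv x : G (flip v x) = G x by exact: pairsum_flip.
  apply: (@le_trans _ _ (mean (fun x => expR (sg x v * h x + G x)))).
    apply: mean_le => x; rewrite ler_expR /G lerD2r /h mulr_sumr.
    by apply: ler_sum => u _; rewrite mulrCA.
  apply: le_trans (mean_expR_sg_le Gv hv) _; apply: mean_le => x.
  rewrite -expRD ler_expR /h sqr_sum_pairsum mulrDl mulrAC divff // mul1r.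
  rewrite mulr_suml -addrA lerD //.
    by apply: ler_sum => u _; rewrite exprMn sg_sqr mulr1.
  rewrite -pairsumD /G; apply: pairsum_le => u w.
  by rewrite /y' /p mulrDl addrC lerD2l mulrACA.
apply: le_trans step _; rewrite meanZ.
apply: le_trans (ler_wpM2l (expR_ge0 _) (IH y' us y'm)) _.
rewrite -expRD ler_expR -/k -/M.
(* In the square of [y u w + p u w], the cross term is the triangle [v, u, w], and the square of [p]
   is of fourth order. *)
have A1 : pairsum (fun u w => y' u w ^+ 2 / 2) s <=
    pairsum (fun u w => y u w ^+ 2 / 2) s +
    pairsum (fun u w => y v u * y v w * y u w) s + k ^+ 2 / 2 * (M ^+ 4 / 2).
  have M40 : 0 <= M ^+ 4 / 2 by rewrite divr_ge0 ?exprn_ge0.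
  apply: le_trans (lerD (lexx _) (pairsum_cst_le s M40)).
  rewrite -!pairsumD; apply: pairsum_le => u w.
  have : p u w ^+ 2 <= M ^+ 4.
    by rewrite -real_normK ?num_real // (_ : M ^+ 4 = (M ^+ 2) ^+ 2) ?lerXn2r ?nnegrE ?exprn_ge0 // -exprM.
  by rewrite /y' -/(p u w); nra.
have A2 : trisum (fun a b c => y' a b * y' a c * y' b c) s <=
    trisum (fun a b c => y a b * y a c * y b c) s + k ^+ 3 / 6 * (7 * M ^+ 4).
  have M40 : 0 <= 7 * M ^+ 4 by rewrite mulr_ge0 ?exprn_ge0.
  rewrite -lerBlDl -[X in _ - X]mul1r -mulNr -trisumZ -trisumD.
  apply: trisum_le_cst => // a b c.
  by rewrite mulN1r lerBlDl; apply: mul3_add_le; rewrite ?M0.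
rewrite -natr1 -/k.
have M40 : 0 <= M ^+ 4 by rewrite exprn_ge0.
have k30 : 0 <= k ^+ 3 by rewrite exprn_ge0.
have A3 : k ^+ 2 / 2 * (M ^+ 4 / 2) + k ^+ 3 / 6 * (7 * M ^+ 4) + k ^+ 4 * M ^+ 4
    <= (k + 1) ^+ 4 * M ^+ 4.
  rewrite -subr_ge0 (_ : _ - _ = (17/6 * k ^+ 3 + 23/4 * k^+2 + 4 * k + 1) * M ^+ 4); last by field.
  by rewrite mulr_ge0 // !addr_ge0 ?mulr_ge0 ?exprn_ge0.
lra.
Qed.

(** Take [m = M^-1] above: since [size s <= m], the sum [m + size s] is at most [2 m]. *)
Lemma mean_expR_pairsum (M : R) y s : uniq s -> 0 < M <= 1 ->
  (size s)%:R * M <= 1 -> (forall u v, `|y u v| <= M / 2) ->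
  mean (fun x => expR (pairsum (fun u v => y u v * (sg x u * sg x v)) s)) <=
  expR (pairsum (fun u v => y u v ^+ 2 / 2) s +
        trisum (fun u v w => y u v * y u w * y v w) s +
        (size s)%:R ^+ 4 * M ^+ 4).
Proof.
move=> us /andP[M0 M1] nM yM.
have := @mean_expR_pairsum_shift M^-1 y s us; rewrite invrK invf_ge1 //.
apply=> // u v; apply: le_trans (yM u v) _.
rewrite -[leRHS]div1r ler_pdivlMr; last by rewrite ltr_wpDr ?invr_gt0.
rewrite mulrDr -mulrA mulrCA divff ?gt_eqF //.
rewrite mulr1; nra.
Qed.

(** The second-order term of [log (1 - t)] cancels the variance term of [mean_expR_pairsum], which
    leaves the triangles as the leading contribution. Their sign is negative because the bound is
    applied to [- y]. *)
Lemma mean_pairprod_le (M : R) y s : uniq s -> 0 < M <= 1 ->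
  (size s)%:R * M <= 1 -> (forall u v, `|y u v| <= M / 2) ->
  mean (fun x => pairprod (fun u v => 1 - y u v * (sg x u * sg x v)) s) <=
  expR (- trisum (fun u v w => y u v * y u w * y v w) s +
        (size s)%:R ^+ 2 * M ^+ 3 + (size s)%:R ^+ 4 * M ^+ 4).
Proof.
move=> us M01 nM yM; have /andP[M0 M1] := M01.
pose c := pairsum (fun u v => - (y u v ^+ 2 / 2)) s + (size s)%:R ^+ 2 / 2 * M ^+ 3.
have y1 u v x : `|y u v * (sg x u * sg x v)| = `|y u v|.
  by rewrite !normrM !normr_sg !mulr1.
have M3 : 0 <= M ^+ 3 by rewrite exprn_ge0 // ltW.
apply: (@le_trans _ _ (mean (fun x => expR c *
    expR (pairsum (fun u v => (- y u v) * (sg x u * sg x v)) s)))).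
  apply: mean_le => x.
  apply: (@le_trans _ _ (expR (pairsum (fun u v => - y u v * (sg x u * sg x v) +
      (- (y u v ^+ 2 / 2) + M ^+ 3)) s))).
    apply: pairprod_le_expR => u v.
    have H := y1 u v x; have yuv := yM u v.
    have h2 : `|y u v * (sg x u * sg x v)| <= 2^-1 by rewrite H; lra.
    rewrite subr_ge0 (le_trans (ler_norm _)) /=; last by lra.
    apply: le_trans (one_sub_le_expR h2) _; rewrite ler_expR.
    rewrite H exprMn exprMn !sg_sqr !mulr1 mulNr addrA lerD2l.
    by apply: lerXn2r; rewrite ?nnegrE ?normr_ge0 //; lra.
  rewrite -expRD ler_expR !pairsumD addrC lerD2r /c lerD2l.
  exact: pairsum_cst_le.
rewrite meanZ; apply: (@le_trans _ _ (expR c * _)).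
  apply: ler_wpM2l; first exact: expR_ge0.
  by apply: (mean_expR_pairsum us M01 nM) => u v; rewrite normrN.
rewrite -expRD ler_expR /c.
have -> : trisum (fun u v w => - y u v * - y u w * - y v w) s =
    - trisum (fun u v w => y u v * y u w * y v w) s.
  by rewrite -[RHS]mulN1r -trisumZ; apply: eq_trisum => a b d; ring.
have -> : pairsum (fun u v => (- y u v) ^+ 2 / 2) s =
    - pairsum (fun u v => - (y u v ^+ 2 / 2)) s.
  by rewrite -[RHS]mulN1r -pairsumZ; apply: eq_pairsum => a b; field.
have : 0 <= (size s)%:R ^+ 2 * M ^+ 3 by rewrite mulr_ge0 // exprn_ge0.
lra.
Qed.

End Signs.

(** * The random walk on the edges *)

Section Process.
Variables (R : realType) (T : finType) (r : nat) (eta om : R).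
Hypothesis r2 : (2 <= r)%N.
Hypothesis om_def : om = (80 * r%:R)^-1.
Hypothesis eta_gt0 : 0 < eta.
Hypothesis eta_om : eta <= om.

(* The first index of a state is meant to be a pair of vertices. *)
Let state := {set T} -> 'I_r.+1 -> R.
Implicit Types (S : state) (X : 'I_r.+1 -> R) (i j : 'I_r.+1) (s : seq T).
Implicit Types (x : {ffun T -> bool}) (u v w : T) (e : {set T}).

Definition active X : bool := [forall j, `|X j| <= om].

(* [(-1)^k] where [k] is [1] if [x] takes both values on [e] and [0] otherwise,
   so that this is [sg x u * sg x v] for [e = {u, v}], even if [u = v]. *)
Definition pair_sign x e : R := (-1) ^+ #|x @: e|.-1.

Definition step j x S : state := fun e i =>
  S e i + (if active (S e) && (i == j) then eta * pair_sign x e else 0).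

(** These biases sum to 0 over the colours, so the numbers [(1 + tilt X i) / r.+1] sum to 1. *)
Definition tilt X i : R := r.+1%:R * X i - \sum_j X j.

(** The box has half-width [om], and a step taken inside it may overshoot by [eta <= om]. *)
Definition bounded S := forall e j, `|S e j| <= 2 * om.

Definition miss_ratio i s S : R :=
  pairprod (fun u v => 1 - tilt (S [set u; v]) i / r%:R) s.

Definition inactive S u v : R := (~~ active (S [set u; v]))%:R.

Definition mostly_active s S : bool :=
  pairsum (inactive S) s < (size s)%:R ^+ 2 / 50.

Definition energy s S : R :=
  pairsum (fun u v => \sum_j S [set u; v] j ^+ 2) s.

(** * Estimates for a single step *)

Let r_gt0 : 0 < r%:R :> R. Proof. by rewrite ltr0n; case: r r2. Qed.
Let r_ge2 : 2 <= r%:R :> R. Proof. by rewrite ler_nat. Qed.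

Let rom : r%:R * om = 80^-1.
Proof. by rewrite om_def invfM mulrCA divff ?mulr1 // gt_eqF. Qed.

Lemma om_gt0 : 0 < om.
Proof. by rewrite om_def invr_gt0 mulr_gt0. Qed.

Lemma pair_signE x u v : pair_sign x [set u; v] = sg R x u * sg R x v.
Proof.
rewrite /pair_sign imsetU1 imset_set1 cards2 /= /sg.
by case: (x u); case: (x v); rewrite ?expr1 ?expr0 ?mulr1 ?mul1r ?mulN1r ?opprK.
Qed.

Lemma normr_pair_sign x e : `|pair_sign x e| = 1.
Proof. by rewrite /pair_sign normrX normrN1 expr1n. Qed.

Lemma bounded_step j x S : bounded S -> bounded (step j x S).
Proof.
move=> bS e i; rewrite /step; case: ifP => [/andP[/forallP/(_ i) act _]|_].
  apply: le_trans (ler_normD _ _) _.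
  rewrite normrM normr_pair_sign mulr1 (ger0_norm (ltW eta_gt0)).
  by move: act eta_om; lra.
by rewrite addr0.
Qed.

Lemma tilt_le S e i : bounded S -> `|tilt (S e) i| <= 20^-1.
Proof.
move=> bS; have -> : tilt (S e) i = r%:R * S e i - \sum_(j | j != i) S e j.
  by rewrite /tilt (bigD1 i) //= -natr1; ring.
apply: le_trans (ler_normB _ _) _.
have A1 : `|r%:R * S e i| <= r%:R * (2 * om).
  by rewrite normrM (ger0_norm (ltW r_gt0)) ler_wpM2l ?bS // ltW.
have A2 : `|\sum_(j | j != i) S e j| <= r%:R * (2 * om).
  apply: le_trans (ler_norm_sum _ _ _) _.
  apply: (@le_trans _ _ (\sum_(j < r.+1 | j != i) (2 * om))).
    by apply: ler_sum => j _; exact: bS.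
  by rewrite sumr_const cardC1 card_ord /= [leRHS]mulr_natl.
have := rom; lra.
Qed.

Lemma tilt_step j x S e i : tilt (step j x S e) i = tilt (S e) i +
  (if i == j then r%:R else -1) * (if active (S e) then eta * pair_sign x e else 0).
Proof.
rewrite /tilt /step big_split /= mulrDr opprD addrACA; congr (_ + _).
case: (active _) => /=; last by rewrite mulr0 sub0r big1 ?oppr0 ?mulr0.
rewrite -big_mkcond /= big_pred1_eq; case: eqP => _; last by rewrite mulr0 sub0r mulN1r.
by rewrite -natr1 mulrDl mul1r addrK.
Qed.

(** For a pair of sign 1, minus the relative change of the factor [1 - tilt / r]; the denominator is
    [r] times that factor. *)
Definition step_coef i j S e : R :=
  if active (S e) then (if i == j then r%:R else -1) * eta / (r%:R - tilt (S e) i)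
  else 0.

Lemma miss_factor_step i j x S e : bounded S ->
  1 - tilt (step j x S e) i / r%:R =
  (1 - tilt (S e) i / r%:R) * (1 - step_coef i j S e * pair_sign x e).
Proof.
move=> /tilt_le -/(_ e i); rewrite ler_norml => /andP[b1 b2].
have d0 : r%:R - tilt (S e) i != 0 by rewrite gt_eqF //; have := r_ge2; lra.
have r0 : r%:R != 0 :> R by rewrite gt_eqF.
rewrite tilt_step /step_coef; case: (active _); last by rewrite mulr0 addr0 mul0r subr0 mulr1.
by field; rewrite d0 r0.
Qed.

Lemma miss_factor_bounds i S e : bounded S ->
  0 <= 1 - tilt (S e) i / r%:R <= 1 + 40^-1.
Proof.
move=> /tilt_le -/(_ e i); rewrite ler_norml => /andP[b1 b2].
have : `|tilt (S e) i / r%:R| <= 40^-1.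
  rewrite normrM normfV (ger0_norm (ltW r_gt0)) ler_pdivrMr // ler_norml.
  by have := r_ge2; lra.
by rewrite ler_norml; lra.
Qed.

Lemma miss_ratio_ge0 i s S : bounded S -> 0 <= miss_ratio i s S.
Proof.
by move=> bS; apply: pairprod_ge0 => u v; case/andP: (miss_factor_bounds i [set u; v] bS).
Qed.

Lemma miss_ratio_le i s S : bounded S ->
  miss_ratio i s S <= expR ((size s)%:R ^+ 2 / 80).
Proof.
move=> bS; apply: le_trans (@pairprod_le_expR _ _ _ (fun _ _ => 40^-1) s _) _.
  move=> u v; have /andP[-> h] := miss_factor_bounds i [set u; v] bS.
  by rewrite (le_trans h) // expR_ge1Dx.
by rewrite ler_expR; apply: le_trans (@pairsum_cst_le _ _ 40^-1 s _) _ => //; lra.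
Qed.

(** Since [|tilt| <= 1/20] and [r >= 2], the ratio [r / (r - tilt)] is within 3 percent of 1. *)
Lemma step_coef_diag i S e : bounded S -> active (S e) ->
  97 / 100 * eta <= step_coef i i S e <= 103 / 100 * eta.
Proof.
move=> /tilt_le -/(_ e i); rewrite ler_norml => /andP[b1 b2] act.
rewrite /step_coef act eqxx; have r2' := r_ge2.
have d0 : 0 < r%:R - tilt (S e) i by lra.
by have e0 := eta_gt0; rewrite ler_pdivlMr // ler_pdivrMr //; apply/andP; split; nra.
Qed.

Lemma step_coef_offdiag i j S e : bounded S -> i != j ->
  - (103 / 100 * eta / r%:R) <= step_coef i j S e <= 0.
Proof.
move=> /tilt_le -/(_ e i); rewrite ler_norml => /andP[b1 b2] /negbTE ij.
have r2' := r_ge2; have d0 : 0 < r%:R - tilt (S e) i by lra.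
have et0 := eta_gt0; have e0 : 0 <= 103 / 100 * eta / r%:R by rewrite divr_ge0 //; lra.
rewrite /step_coef ij; case: (active _); last by rewrite oppr_le0 e0 lexx.
rewrite mulN1r mulNr lerN2 oppr_le0; apply/andP; split; last by rewrite divr_ge0 // ltW.
rewrite ler_pdivrMr // mulrAC ler_pdivlMr //.
by nra.
Qed.

Lemma step_coef_le i j S e : bounded S -> `|step_coef i j S e| <= 4 * eta / 2.
Proof.
move=> bS; have e0 := eta_gt0; have r2' := r_ge2; rewrite ler_norml.
have [->|ij] := eqVneq j i.
  case: (boolP (active (S e))) => [act|/negbTE act].
    by have := step_coef_diag i bS act; lra.
  by rewrite /step_coef act; lra.
rewrite eq_sym in ij; have /andP[h1 h2] := step_coef_offdiag e bS ij.
have : 103 / 100 * eta / r%:R <= 2 * eta by rewrite ler_pdivrMr //; nra.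
lra.
Qed.

Definition step_error s : R :=
  (size s)%:R ^+ 2 * (4 * eta) ^+ 3 + (size s)%:R ^+ 4 * (4 * eta) ^+ 4.

Lemma mean_miss_ratio_step i j s S : uniq s -> 4 * eta <= 1 ->
  (size s)%:R * (4 * eta) <= 1 -> bounded S ->
  mean (fun x => miss_ratio i s (step j x S)) <=
  expR (- trisum (fun u v w => step_coef i j S [set u; v] *
       step_coef i j S [set u; w] * step_coef i j S [set v; w]) s + step_error s)
  * miss_ratio i s S.
Proof.
move=> us M1 nM bS.
have -> : mean (fun x => miss_ratio i s (step j x S)) = mean (fun x =>
    miss_ratio i s S * pairprod (fun u v => 1 - step_coef i j S [set u; v] *
      (sg R x u * sg R x v)) s).
  congr (mean _); apply/funext => x; rewrite /miss_ratio -pairprodM.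
  by apply: eq_pairprod => u v; rewrite miss_factor_step // pair_signE.
rewrite meanZ mulrC ler_wpM2r ?miss_ratio_ge0 //.
rewrite /step_error addrA; apply: mean_pairprod_le => //.
  by have := eta_gt0; lra.
by move=> u v; exact: step_coef_le.
Qed.

(** Of at least [n^3 / 7] triples, at most [n^3 / 50] contain an inactive pair, and these contribute
    0. Each other one contributes at least [91/100 * eta^3], and [91/100 * (1/7 - 1/50) >= 1/9]. *)
Lemma trisum_coef_diag i s S : bounded S -> (21 <= size s)%N ->
  mostly_active s S -> eta ^+ 3 * (size s)%:R ^+ 3 / 9 <=
  trisum (fun u v w => step_coef i i S [set u; v] *
       step_coef i i S [set u; w] * step_coef i i S [set v; w]) s.
Proof.
move=> bS s21 act; set n : R := (size s)%:R.
have n21 : 21 <= n by rewrite ler_nat.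
have e3 : 0 <= eta ^+ 3 by rewrite exprn_ge0 // ltW.
have D e : 97 / 100 * eta * (active (S e))%:R <= step_coef i i S e.
  case: (boolP (active (S e))) => a; last by rewrite mulr0 /step_coef (negbTE a).
  by rewrite mulr1; case/andP: (step_coef_diag i bS a).
have D0 e : 0 <= 97 / 100 * eta * (active (S e))%:R.
  by rewrite mulr_ge0 ?ler0n //; have := eta_gt0; lra.
pose c := 91 / 100 * eta ^+ 3.
have c0 : 0 <= c by rewrite /c; lra.
(* Union bound: the indicator that all three sides are active is at least 1 minus the number of
   inactive sides. *)
apply: (@le_trans _ _ (trisum (fun u v w => c * (1 + (- 1) *
    (inactive S u v + inactive S u w + inactive S v w))) s)); last first.
  apply: trisum_le => u v w; rewrite /inactive.
  apply: (@le_trans _ _ (97 / 100 * eta * (active (S [set u; v]))%:R *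
     (97 / 100 * eta * (active (S [set u; w]))%:R) *
     (97 / 100 * eta * (active (S [set v; w]))%:R))); last first.
    by rewrite !ler_pM //; apply: mulr_ge0.
  have -> : 97 / 100 * eta * (active (S [set u; v]))%:R *
     (97 / 100 * eta * (active (S [set u; w]))%:R) *
     (97 / 100 * eta * (active (S [set v; w]))%:R) =
     (97 / 100) ^+ 3 * eta ^+ 3 * ((active (S [set u; v]))%:R *
     (active (S [set u; w]))%:R * (active (S [set v; w]))%:R) by ring.
  rewrite /c; case: (active _); case: (active _); case: (active _) => /=; lra.
rewrite trisumZ trisumD trisumZ trisum1 -/n.
have T3 : trisum (fun u v w => inactive S u v + inactive S u w + inactive S v w) s
    <= n * (n ^+ 2 / 50).
  apply: le_trans (@trisum_pairs_le _ _ (inactive S) s _) _.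
    by move=> u v; rewrite ler0n.
  by rewrite -/n ler_wpM2l ?ler0n // ltW.
have C3 : n ^+ 3 / 7 <= 'C(size s, 3)%:R.
  have : ('C(size s, 3) * 6 = size s * (size s - 1) * (size s - 2))%N.
    by rewrite -[6%N]/(3`!) bin_ffact !ffactnSr ffactn0 mul1n subn0.
  move=> /(congr1 (fun k => k%:R : R)); rewrite !natrM !natrB ?(leq_trans _ s21) //.
  rewrite -/n; set B : R := _%:R; move=> HB.
  have : n ^+ 3 * 6 <= 7 * (n * (n - 1) * (n - 2)) by nra.
  lra.
apply: (@le_trans _ _ (c * (n ^+ 3 / 7 - n ^+ 3 / 50))); last first.
  by rewrite ler_wpM2l // mulN1r lerB //; apply: le_trans T3 _; rewrite exprS mulrA.
rewrite /c; have : 0 <= eta ^+ 3 * n ^+ 3 by rewrite mulr_ge0 // exprn_ge0 //; lra.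
lra.
Qed.

(** The negated coefficients lie between 0 and [103/100 * eta / r], there are at most [n^3 / 6]
    triples, and [(103/100)^3 / 6 <= 11/60]. *)
Lemma trisum_coef_offdiag i j s S : bounded S -> i != j ->
  - trisum (fun u v w => step_coef i j S [set u; v] *
       step_coef i j S [set u; w] * step_coef i j S [set v; w]) s <=
  eta ^+ 3 * (size s)%:R ^+ 3 * (11 / 60) / r%:R ^+ 3.
Proof.
move=> bS ij; set n : R := (size s)%:R.
pose b := 103 / 100 * eta / r%:R.
have b0 : 0 <= b by rewrite divr_ge0 //; have := eta_gt0; lra.
have n0 : 0 <= n by rewrite ler0n.
have H e : 0 <= - step_coef i j S e <= b.
  by have := step_coef_offdiag e bS ij; rewrite -/b; lra.
have -> : - trisum (fun u v w => step_coef i j S [set u; v] *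
     step_coef i j S [set u; w] * step_coef i j S [set v; w]) s =
    trisum (fun u v w => (- step_coef i j S [set u; v]) *
     (- step_coef i j S [set u; w]) * (- step_coef i j S [set v; w])) s.
  by rewrite -[LHS]mulN1r -trisumZ; apply: eq_trisum => u v w; ring.
apply: le_trans (@trisum_le_cst _ _ _ (b ^+ 3) s _ _) _.
- exact: exprn_ge0.
- move=> u v w; rewrite !exprS expr0 mulr1 mulrA.
  have /andP[? ?] := H [set u; v]; have /andP[? ?] := H [set u; w].
  by have /andP[? ?] := H [set v; w]; rewrite !ler_pM ?mulr_ge0.
rewrite -/n /b expr_div_n exprMn mulrA ler_wpM2r ?invr_ge0 ?exprn_ge0 ?(ltW r_gt0) //.
have : 0 <= eta ^+ 3 * n ^+ 3 by rewrite mulr_ge0 // exprn_ge0 // ltW.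
lra.
Qed.

(** A pair outside the box is frozen, so inactivity is permanent. *)
Lemma inactive_step j x S u v : inactive S u v <= inactive (step j x S) u v.
Proof.
rewrite /inactive; case: (boolP (active (S _))) => [_|a] /=; first exact: ler0n.
rewrite (_ : step j x S [set u; v] = S [set u; v]) ?a //.
by apply/funext => i; rewrite /step (negbTE a) addr0.
Qed.

Lemma mostly_active_step j x s S : mostly_active s (step j x S) -> mostly_active s S.
Proof.
by apply: le_lt_trans; apply: pairsum_le => u v; exact: inactive_step.
Qed.

(** Truncation to the states where the triangle gain is guaranteed. As inactivity is permanent, a
    truncated state stays truncated, and the one-step bound holds at every bounded state. *)
Definition active_miss_ratio i s S : R :=
  if mostly_active s S then miss_ratio i s S else 0.

Definition rate i s j : R := (if i == j then - (eta ^+ 3 * (size s)%:R ^+ 3 / 9)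
  else eta ^+ 3 * (size s)%:R ^+ 3 * (11 / 60) / r%:R ^+ 3) + step_error s.

Lemma mean_active_miss_ratio_step i j s S : uniq s -> (21 <= size s)%N ->
  4 * eta <= 1 -> (size s)%:R * (4 * eta) <= 1 -> bounded S ->
  mean (fun x => active_miss_ratio i s (step j x S)) <=
  expR (rate i s j) * active_miss_ratio i s S.
Proof.
move=> us s21 M1 nM bS; rewrite /active_miss_ratio.
case: (boolP (mostly_active s S)) => act; last first.
  rewrite mulr0 -[leRHS](mean_cst _ (card_signs_gt0 T)).
  by apply: mean_le => x; case: ifP => [/mostly_active_step|_]; rewrite ?(negbTE act).
apply: (@le_trans _ _ (mean (fun x => miss_ratio i s (step j x S)))).
  apply: mean_le => x; case: ifP => // _.
  exact/miss_ratio_ge0/bounded_step.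
apply: le_trans (mean_miss_ratio_step i j us M1 nM bS) _.
rewrite ler_wpM2r ?miss_ratio_ge0 // ler_expR /rate lerD2r.
have [<-|ij] := eqVneq i j; last exact: trisum_coef_offdiag.
by rewrite lerN2; exact: trisum_coef_diag.
Qed.

(** On an active pair the [j]-th square grows by [eta^2], a drift, plus [2 eta X_j x_u x_v]. After
    multiplication by [g] the latter is a quadratic form in the signs with coefficients at most
    [M / 2], whose exponential moment is at most [exp (2 n^2 M^2)]. *)
Lemma mean_energy_step (g : R) j s S : uniq s -> 0 < g ->
  4 * g * eta * om <= 1 -> (size s)%:R * (4 * g * eta * om) <= 1 ->
  mean (fun x => expR (g * energy s (step j x S))) <=
  expR (eta ^+ 2 * (size s)%:R ^+ 2 * (g / 2 + 32 * g ^+ 2 * om ^+ 2)) *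
  expR (g * energy s S).
Proof.
move=> us g0; set M := 4 * g * eta * om; set n : R := (size s)%:R => M1 nM.
have o0 := om_gt0; have e0 := eta_gt0; have n0 : 0 <= n by rewrite ler0n.
have M0 : 0 < M by rewrite !mulr_gt0.
pose y u v := if active (S [set u; v]) then 2 * g * eta * S [set u; v] j else 0.
have yM u v : `|y u v| <= M / 2.
  rewrite /y; case: (boolP (active _)) => [/forallP/(_ j) a|_]; last by rewrite normr0; lra.
  have g2 : 0 < 2 * g * eta by rewrite !mulr_gt0.
  rewrite normrM (gtr0_norm g2) /M.
  by apply: le_trans (ler_wpM2l (ltW g2) a) _; lra.
have E x : g * energy s (step j x S) <= g * energy s S + g * eta ^+ 2 * (n ^+ 2 / 2) +
    pairsum (fun u v => y u v * (sg R x u * sg R x v)) s.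
  have c0 : 0 <= g * eta ^+ 2 by rewrite mulr_ge0 ?sqr_ge0 // ltW.
  rewrite /energy [_ * (n ^+ 2 / 2)]mulrC.
  apply: le_trans (lerD (lerD (lexx _) (pairsum_cst_le s c0)) (lexx _)).
  rewrite -!pairsumZ -!pairsumD; apply: pairsum_le => u v.
  rewrite (bigD1 j) //= [in leRHS](bigD1 j) //= /step eqxx andbT.
  rewrite (eq_bigr (fun k => S [set u; v] k ^+ 2)); last first.
    by move=> k /negbTE ->; rewrite andbF addr0.
  rewrite /y -pair_signE; case: (active _); last by rewrite addr0 mul0r addr0 ler_wpDr.
  have p2 : pair_sign x [set u; v] ^+ 2 = 1.
    by rewrite -real_normK ?num_real // normr_pair_sign expr1n.
  set p := pair_sign _ _ in p2 *; set B := \sum_(_ < _ | _) _; set X := S _ _.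
  have -> : (X + eta * p) ^+ 2 = X ^+ 2 + 2 * eta * X * p + eta ^+ 2 * p ^+ 2 by ring.
  by rewrite p2; lra.
apply: (@le_trans _ _ (mean (fun x => expR (g * energy s S + g * eta ^+ 2 * (n ^+ 2 / 2)) *
   expR (pairsum (fun u v => y u v * (sg R x u * sg R x v)) s)))).
  by apply: mean_le => x; rewrite -expRD ler_expR.
have M01 : 0 < M <= 1 by rewrite M0 M1.
rewrite meanZ; apply: le_trans (ler_wpM2l (expR_ge0 _) (mean_expR_pairsum us M01 nM yM)) _.
rewrite -!expRD ler_expR -/n.
have M0' := ltW M0.
have B1 : pairsum (fun u v => y u v ^+ 2 / 2) s <= n ^+ 2 / 2 * (M ^+ 2 / 8).
  apply: pairsum_le_cst; first by rewrite divr_ge0 ?sqr_ge0.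
  move=> u v; have : y u v ^+ 2 <= (M / 2) ^+ 2.
    by rewrite -real_normK ?num_real // lerXn2r ?nnegrE //; lra.
  by rewrite expr_div_n; lra.
have B2 : trisum (fun u v w => y u v * y u w * y v w) s <= n ^+ 3 / 6 * (M ^+ 3 / 8).
  apply: trisum_le_cst; first by rewrite divr_ge0 ?exprn_ge0.
  move=> u v w; apply: le_trans (ler_norm _) _; rewrite !normrM.
  have -> : M ^+ 3 / 8 = M / 2 * (M / 2) * (M / 2) by field.
  by rewrite !ler_pM ?mulr_ge0.
have nM0 : 0 <= n * M by rewrite mulr_ge0.
have B3 : n ^+ 3 * M ^+ 3 <= n ^+ 2 * M ^+ 2.
  by rewrite -!exprMn exprS ler_piMl ?exprn_ge0.
have B4 : n ^+ 4 * M ^+ 4 <= n ^+ 2 * M ^+ 2.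
  rewrite -!exprMn (_ : (n * M) ^+ 4 = (n * M) ^+ 2 * (n * M) ^+ 2); last by rewrite -exprD.
  by rewrite ler_piMl ?exprn_ge0 // exprn_ile1.
have -> : eta ^+ 2 * n ^+ 2 * (g / 2 + 32 * g ^+ 2 * om ^+ 2) =
  g * eta ^+ 2 * (n ^+ 2 / 2) + 2 * (n ^+ 2 * M ^+ 2) by rewrite /M; field.
have : 0 <= n ^+ 2 * M ^+ 2 by rewrite mulr_ge0 ?sqr_ge0.
lra.
Qed.

(** * Expectations over a sequence of steps *)

Fixpoint expected (js : seq 'I_r.+1) (F : state -> R) S : R :=
  if js is j :: js' then mean (fun x => expected js' F (step j x S)) else F S.

Lemma expected_le js (F G : state -> R) S : bounded S ->
  (forall S', bounded S' -> F S' <= G S') -> expected js F S <= expected js G S.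
Proof.
move=> bS FG; elim: js S bS => [|j js IH] S bS /=; first exact: FG.
by apply: mean_le => x; exact/IH/bounded_step.
Qed.

Lemma expectedZ js (c : R) F S : expected js (fun S' => c * F S') S = c * expected js F S.
Proof.
elim: js S => //= j js IH S; rewrite -meanZ; congr (mean _).
by apply/funext => x; exact: IH.
Qed.

Lemma expectedD js F G S :
  expected js (fun S' => F S' + G S') S = expected js F S + expected js G S.
Proof.
elim: js S => //= j js IH S; rewrite -meanD; congr (mean _).
by apply/funext => x; exact: IH.
Qed.

Lemma expected_sum (I : finType) (P : pred I) js (F : I -> state -> R) S :
  expected js (fun S' => \sum_(k | P k) F k S') S = \sum_(k | P k) expected js (F k) S.
Proof.
elim: js S => //= j js IH S; rewrite -mean_sum; congr (mean _).
by apply/funext => x; exact: IH.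
Qed.

Lemma expected_supermartingale js (F : state -> R) (rho : 'I_r.+1 -> R) S : bounded S ->
  (forall j S', bounded S' -> mean (fun x => F (step j x S')) <= expR (rho j) * F S') ->
  expected js F S <= expR (\sum_(j <- js) rho j) * F S.
Proof.
move=> bS mF; elim: js S bS => [|j js IH] S bS /=; first by rewrite big_nil expR0 mul1r.
apply: (@le_trans _ _ (mean (fun x => expR (\sum_(j <- js) rho j) * F (step j x S)))).
  by apply: mean_le => x; exact/IH/bounded_step.
rewrite meanZ big_cons expRD [expR (rho j) * _]mulrC -mulrA ler_wpM2l ?expR_ge0 //.
exact: mF.
Qed.

Lemma expected_ge_ex js (F : state -> R) S : bounded S ->
  exists2 S', bounded S' & F S' <= expected js F S.
Proof.
elim: js S => [|j js IH] S bS /=; first by exists S.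
have [x hx] := mean_ge_ex (fun x => expected js F (step j x S)) (card_signs_gt0 T).
have [S' bS' hS'] := IH _ (bounded_step j x bS).
by exists S' => //; exact: le_trans hS' hx.
Qed.

Lemma inactive_le_energy s S :
  om ^+ 2 * pairsum (inactive S) s <= energy s S.
Proof.
rewrite -pairsumZ; apply: pairsum_le => u v; rewrite /inactive.
case: (boolP (active _)) => [_|] /=; first by rewrite mulr0 sumr_ge0 // => j _; exact: sqr_ge0.
rewrite negb_forall mulr1 => /existsP[j]; rewrite -ltNge => /ltW Sj.
rewrite (bigD1 j) //= ler_wpDr ?sumr_ge0 // => [k _|]; first exact: sqr_ge0.
by rewrite -[leRHS]real_normK ?num_real // lerXn2r // nnegrE ltW // om_gt0.
Qed.

(* A state which is not mostly active has energy at least [om^2 n^2 / 50]. *)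
Lemma miss_ratio_le_active i s S : bounded S ->
  miss_ratio i s S <= active_miss_ratio i s S +
    expR ((size s)%:R ^+ 2 / 80 - 2 * (size s)%:R ^+ 2) *
    expR (100 / om ^+ 2 * energy s S).
Proof.
move=> bS; rewrite /active_miss_ratio; case: (boolP (mostly_active s S)) => [_|].
  by rewrite ler_wpDr // mulr_ge0 ?expR_ge0.
rewrite /mostly_active -leNgt add0r -expRD => a.
apply: le_trans (miss_ratio_le i s bS) _; rewrite ler_expR -addrA lerDl.
have o2 : 0 < om ^+ 2 by rewrite exprn_gt0 ?om_gt0.
rewrite addrC subr_ge0 -ler_pdivrMl ?divr_gt0 // invfM invrK.
apply: le_trans (inactive_le_energy s S).
rewrite [100^-1 * _]mulrC -mulrA ler_wpM2l ?(ltW o2) //; lra.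
Qed.

(** The factor from [mean_energy_step] at [g = 100 / om^2]; this [g] turns the energy
    [om^2 n^2 / 50] into the exponent [2 n^2]. *)
Definition energy_const : R := 100 / om ^+ 2 / 2 + 32 * (100 / om ^+ 2) ^+ 2 * om ^+ 2.

(** The first term bounds the truncated ratio, the second the states with many inactive pairs,
    through the exponential moment of the energy. Both processes have value 1 at the zero state. *)
Lemma expected_miss_ratio_le i js s : uniq s -> (21 <= size s)%N ->
  4 * eta <= 1 -> (size s)%:R * (4 * eta) <= 1 ->
  4 * (100 / om ^+ 2) * eta * om <= 1 ->
  (size s)%:R * (4 * (100 / om ^+ 2) * eta * om) <= 1 ->
  expected js (miss_ratio i s) (fun _ _ => 0) <=
  expR (\sum_(j <- js) rate i s j) +
  expR ((size s)%:R ^+ 2 / 80 - 2 * (size s)%:R ^+ 2 +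
    (eta ^+ 2 * (size s)%:R ^+ 2 * energy_const) *+ size js).
Proof.
move=> us s21 M1 nM M1' nM'; set S0 : state := fun _ _ => 0.
have bS0 : bounded S0 by move=> e j; rewrite normr0 mulr_ge0 // ltW // om_gt0.
have act0 : mostly_active s S0.
  rewrite /mostly_active (@eq_pairsum _ _ _ (fun _ _ => 0 * 0)) => [|u v].
    by rewrite pairsumZ mul0r divr_gt0 // exprn_gt0 // ltr0n (leq_trans _ s21).
  rewrite mul0r /inactive (_ : active _) //; apply/forallP => j.
  by rewrite normr0 ltW // om_gt0.
have Z0 : active_miss_ratio i s S0 = 1.
  rewrite /active_miss_ratio act0 /miss_ratio (@eq_pairprod _ _ _ (fun _ _ => 1)) => [|u v].
    by rewrite pairprod_cst expr1n.
  by rewrite /tilt /S0 mulr0 big1 // subr0 mul0r subr0.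
have E0 : energy s S0 = 0.
  rewrite /energy (@eq_pairsum _ _ _ (fun _ _ => 0 * 0)) ?pairsumZ ?mul0r // => u v.
  by rewrite ?mul0r big1 // => j _; rewrite expr0n.
have := expected_le js bS0 (miss_ratio_le_active i s).
rewrite expectedD expectedZ => H; apply: le_trans H _; apply: lerD.
  apply: le_trans (@expected_supermartingale js (active_miss_ratio i s) (rate i s) _ bS0 _) _.
    by move=> j S' bS'; exact: mean_active_miss_ratio_step.
  by rewrite Z0 mulr1.
rewrite [leRHS]expRD ler_wpM2l ?expR_ge0 //.
have g0 : 0 < 100 / om ^+ 2 by rewrite divr_gt0 // exprn_gt0 // om_gt0.
apply: le_trans (@expected_supermartingale js (fun S => expR (100 / om ^+ 2 * energy s S))
  (fun=> eta ^+ 2 * (size s)%:R ^+ 2 * energy_const) _ bS0 _) _.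
  by move=> j S' bS'; exact: mean_energy_step.
by rewrite E0 mulr0 expR0 mulr1 big_const_seq count_predT iter_addr_0.
Qed.

End Process.

(** * From probabilities to colourings *)

Section Colouring.
Variables (R : realType) (r n N : nat).

Lemma prod_subsets2 (T : finType) (f : {set T} -> R) (s : seq T) : uniq s ->
  \prod_(B : {set T} | (#|B| == 2) && (B \subset [set u in s])) f B =
  pairprod (fun u v => f [set u; v]) s.
Proof.
elim: s => [|v s IH] /=.
  move=> _; rewrite big1 // => B /andP[/cards2P[a [b [_ ->]]]].
  by rewrite finset.subUset finset.sub1set inE.
move=> /andP[vs us]; rewrite -IH // (bigID (fun B : {set T} => v \in B)) /=; congr (_ * _).
  rewrite big_uniq //= [LHS](eq_bigl (fun B => B \in [set [set v; u] | u in s])) => [|B].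
    rewrite big_imset //= => u w us' ws' /finset.setP/(_ u).
    rewrite !inE eqxx orbT => /esym/orP[/eqP uv|/eqP //].
    by rewrite -uv us' in vs.
  apply/andP/finset.imsetP => [[/andP[/cards2P[a [b [ab ->]]]]]|[u us' ->]]; last first.
    rewrite cards2 !inE eqxx; split=> //; apply/andP; split.
      by rewrite eqSS eqb1; apply: contraNneq vs => ->.
    by rewrite finset.subUset !finset.sub1set !inE eqxx us' orbT.
  rewrite finset.subUset !finset.sub1set !inE => /andP[/orP aS /orP bS] /orP[/eqP va|/eqP vb].
    exists b; last by rewrite va.
    by case: bS => // /eqP bv; rewrite bv va eqxx in ab.
  exists a; last by rewrite vb finset.setUC.
  by case: aS => // /eqP av; rewrite av vb eqxx in ab.
apply: eq_bigl => B; rewrite -andbA; congr (_ && _).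
apply/andP/fintype.subsetP => [[/fintype.subsetP BS vB] u uB|BS].
  move: (BS u uB); rewrite !inE => /orP[/eqP uv|//].
  by rewrite uv (negbTE vB) in uB.
split; last by apply: contra vs => /BS; rewrite inE.
by apply/fintype.subsetP => u /BS; rewrite !inE orbC => ->.
Qed.

Lemma prod_edges (f : {set 'I_N} -> R) (A : {set 'I_N}) :
  \prod_(e : edge N | val e \subset A) f (val e) =
  pairprod (fun u v => f [set u; v]) (enum A).
Proof.
rewrite -prod_subsets2 ?enum_uniq // (_ : [set u in enum A] = A); last first.
  by apply/finset.setP => u; rewrite inE mem_enum.
rewrite [RHS](reindex_omap (val : edge N -> _) insub) => [|B /andP[B2 _]].
  by apply: eq_bigl => -[B B2] /=; rewrite insubT B2 /= eqxx andbT.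
by rewrite insubT.
Qed.

(** First moment method for edges coloured independently with distribution [w e]: the product is the
    probability that [A] misses [i]. *)
Lemma not_arrows_of_weights (w : edge N -> 'I_r.+1 -> R) :
  (forall e i, 0 <= w e i) -> (forall e, \sum_i w e i = 1) ->
  \sum_(A : {set 'I_N} | #|A| == n)
    \sum_i \prod_(e : edge N | val e \subset A) (1 - w e i) < 1 ->
  ~~ arrows r n N.
Proof.
move=> w0 w1; apply: contraTN => /forallP arr; rewrite -leNgt.
have sum1 : \sum_(c : {ffun edge N -> 'I_r.+1}) \prod_e w e (c e) = 1.
  by rewrite -bigA_distr_bigA big1.
rewrite -[leLHS]sum1.
(* The factor of one edge in the indicator that [A] misses [i]; edges outside [A] contribute 1. *)
pose ok (A : {set 'I_N}) (i : 'I_r.+1) (e : edge N) (j : 'I_r.+1) : R :=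
  ((val e \subset A) ==> (j != i))%:R.
apply: (@le_trans _ _ (\sum_(c : {ffun edge N -> 'I_r.+1}) \prod_e w e (c e) *
   \sum_(A : {set 'I_N} | #|A| == n) \sum_i \prod_e ok A i e (c e))).
  apply: ler_sum => c _; rewrite ler_peMr ?prodr_ge0 //.
  have /existsP[A /andP[An cA]] := arr c.
  have [i ic] : exists i, i \notin colours_on c A.
    apply/existsP; rewrite -negb_forall; apply/negP => /forallP H.
    have : (#|[set: 'I_r.+1]| <= #|colours_on c A|)%N.
      by apply/subset_leq_card/fintype.subsetP.
    by rewrite cardsT card_ord leqNgt ltnS cA.
  have ok0 (B : {set 'I_N}) j : 0 <= \prod_e ok B j e (c e).
    by apply: prodr_ge0 => e _; exact: ler0n.
  rewrite (bigD1 A) //= ler_wpDr ?sumr_ge0 // => [B _|]; first exact: sumr_ge0.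
  rewrite (bigD1 i) //= ler_wpDr ?sumr_ge0 //.
  rewrite big1 // => e _; rewrite /ok; case: (boolP (val e \subset A)) => //= eA.
  case: eqP => // cei; case/negP: ic; rewrite -cei; apply/finset.imsetP; exists e => //.
  by rewrite inE.
under eq_bigr do rewrite mulr_sumr.
rewrite exchange_big /=; apply: ler_sum => A _.
under eq_bigr do rewrite mulr_sumr.
rewrite exchange_big /=; apply: ler_sum => i _.
under eq_bigr do rewrite -big_split /=.
(* Distributivity turns the sum over colourings into a product over edges, where an edge outside [A]
   gives 1 and one inside gives [1 - w e i]. *)
rewrite -(bigA_distr_bigA (fun e j => w e j * ok A i e j)) [leRHS]big_mkcond /=.
apply: ler_prod => e _; rewrite sumr_ge0 => [|j _]; last by rewrite mulr_ge0 ?ler0n.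
rewrite /ok /=; case: (val e \subset A) => /=; last first.
  by under eq_bigr do rewrite mulr1; rewrite w1.
rewrite (bigD1 i) //= eqxx mulr0 add0r -[X in _ <= X - _](w1 e) [in leRHS](bigD1 i) //= addrAC subrr add0r.
by apply: ler_sum => j ->; rewrite mulr1.
Qed.

End Colouring.

Lemma prod_miss_eq (R : realType) (r : nat) (T : finType)
    (S : {set T} -> 'I_r.+1 -> R) (i : 'I_r.+1) (s : seq T) : (0 < r)%N ->
  pairprod (fun u v => 1 - (1 + tilt (S [set u; v]) i) / r.+1%:R) s =
  (r%:R / r.+1%:R) ^+ 'C(size s, 2) * miss_ratio i s S.
Proof.
move=> r0; rewrite -pairprod_cst -pairprodM; apply: eq_pairprod => u v.
have r0' : r%:R != 0 :> R by rewrite pnatr_eq0 -lt0n.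
have r1 : 1 + r%:R != 0 :> R by rewrite addrC natr1 pnatr_eq0.
by rewrite -natr1; field; rewrite r0' addrC r1.
Qed.

(** Two stages of randomness: averaging over the vertex signs yields one final state for which the
    expected number of pairs [(A, i)] with [A] missing [i] is below 1; given that state the edges
    are independent. *)
Lemma not_arrows_of_expected (R : realType) (r n N : nat) (eta om eps : R)
    (js : seq 'I_r.+1) : (2 <= r)%N -> om = (80 * r%:R)^-1 -> 0 < eta -> eta <= om ->
  (forall (A : {set 'I_N}) i, #|A| = n ->
    expected eta om js (miss_ratio i (enum A)) (fun _ _ => 0) <= eps) ->
  'C(N, n)%:R * r.+1%:R * (r%:R / r.+1%:R) ^+ 'C(n, 2) * eps < 1 ->
  ~~ arrows r n N.
Proof.
move=> r2 omE eta0 etaom Heps lt1.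
have r0 : (0 < r)%N by apply: leq_trans r2.
set S0 : {set 'I_N} -> 'I_r.+1 -> R := fun _ _ => 0.
have o0 := om_gt0 r2 omE.
have bS0 : bounded om S0 by move=> e j; rewrite normr0; lra.
pose q : R := (r%:R / r.+1%:R) ^+ 'C(n, 2).
pose F (S : {set 'I_N} -> 'I_r.+1 -> R) :=
  \sum_(A : {set 'I_N} | #|A| == n) \sum_i q * miss_ratio i (enum A) S.
have F1 : expected eta om js F S0 < 1.
  apply: le_lt_trans lt1; rewrite expected_sum.
  apply: (@le_trans _ _ (\sum_(A : {set 'I_N} | #|A| == n) \sum_(i < r.+1) q * eps)).
    apply: ler_sum => A /eqP An; rewrite expected_sum; apply: ler_sum => i _.
    by rewrite expectedZ ler_wpM2l ?Heps // exprn_ge0 // divr_ge0.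
  rewrite !sumr_const card_ord.
  rewrite (_ : #|[pred A : {set 'I_N} | #|A| == n]| = 'C(N, n)); last first.
    by rewrite -[N in RHS]card_ord -card_draws cardsE.
  by rewrite -[_ *+ _ *+ _]mulr_natl -[_ *+ r.+1]mulr_natl !mulrA.
have [S bS FS] := expected_ge_ex eta0 etaom js F bS0.
apply: (@not_arrows_of_weights R r n N
  (fun e i => (1 + tilt (S (val e)) i) / r.+1%:R)) => [e i|e|].
- have := tilt_le r2 omE (val e) i bS; rewrite ler_norml => /andP[h _].
  by rewrite divr_ge0 //; lra.
- rewrite -mulr_suml big_split /= sumr_const card_ord /tilt sumrB sumr_const card_ord.
  by rewrite -mulr_sumr mulr_natl subrr addr0 divff // pnatr_eq0.
apply: le_lt_trans F1; apply: le_trans FS; apply: ler_sum => A /eqP An.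
apply: ler_sum => i _; rewrite /q -An cardE -prod_miss_eq //.
by rewrite (prod_edges (fun B => 1 - (1 + tilt (S B) i) / r.+1%:R)).
Qed.

(** * Choice of the parameters *)

Section Rounds.
Variables (R : realType) (r : nat).
Hypothesis r2 : (2 <= r)%N.

Lemma sum_rounds (d : nat) (f : 'I_r.+1 -> R) :
  \sum_(j <- flatten (nseq d (enum 'I_r.+1))) f j = d%:R * \sum_j f j.
Proof.
rewrite mulr_natl; elim: d => [|d IH] /=; first by rewrite big_nil.
by rewrite big_cat /= IH big_enum mulrS.
Qed.

(* Where [2 <= r] is needed: the [r] rounds aimed at other colours cost
   [r * r ^ -3] times what the round aimed at colour [i] gains. *)
Lemma sum_rate_le (T : finType) (eta : R) (i : 'I_r.+1) (s : seq T) :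
  0 < eta -> (0 < size s)%N ->
  r.+1%:R * (64 / (size s)%:R + 256 * ((size s)%:R * eta)) <= 15 / 1000 ->
  \sum_j rate eta i s j <= - (eta ^+ 3 * (size s)%:R ^+ 3 / 20).
Proof.
move=> eta0 s0; set n : R := (size s)%:R => H.
have n0 : 0 < n by rewrite ltr0n.
have r2' : 2 <= r%:R :> R by rewrite ler_nat.
set Y := eta ^+ 3 * n ^+ 3; have Y0 : 0 <= Y by rewrite mulr_ge0 ?exprn_ge0 ?ltW.
rewrite /rate big_split /= sumr_const card_ord -[_ *+ r.+1]mulr_natl -/n -/Y.
rewrite (bigD1 i) //= eqxx (eq_bigr (fun=> Y * (11 / 60) / r%:R ^+ 3)) => [|j ji]; last first.
  by rewrite eq_sym (negbTE ji).
rewrite sumr_const cardC1 card_ord /= -[_ *+ r]mulr_natl.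
(* Gain, loss to the other colours and error are balanced by [1/9 - 11/240 - 15/1000 >= 1/20]. *)
have E : r.+1%:R * step_error eta s <= Y * (15 / 1000).
  have -> : step_error eta s = Y * (64 / n + 256 * (n * eta)).
    by rewrite /step_error -/n /Y; field; rewrite gt_eqF.
  by rewrite mulrCA ler_wpM2l.
have B : r%:R * (Y * (11 / 60) / r%:R ^+ 3) <= Y * (11 / 240).
  have -> : r%:R * (Y * (11 / 60) / r%:R ^+ 3) = Y * (11 / 60) / r%:R ^+ 2.
    by field; rewrite gt_eqF //; lra.
  rewrite ler_pdivrMr; last by rewrite exprn_gt0 //; lra.
  have r4 : 0 <= r%:R ^+ 2 - 4 :> R by nra.
  by have := mulr_ge0 Y0 r4; lra.
lra.
Qed.

(** The walk consists of [d] rounds, each aimed once at every colour, with [eta] of order [n^-2] and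
    [d] of order [eta^-2]. The energy exponent then grows by at most [n^2], while the miss ratio
    gains [exp (- n)]. *)
Lemma exists_parameters : exists D : R, forall (n N : nat), D <= n%:R ->
  exists (eta : R) (js : seq 'I_r.+1),
    [/\ 0 < eta, eta <= (80 * r%:R)^-1 & forall (A : {set 'I_N}) i, #|A| = n ->
      expected eta (80 * r%:R)^-1 js (miss_ratio i (enum A)) (fun _ _ => 0) <=
      2 * expR (- n%:R)].
Proof.
have r2' : 2 <= r%:R :> R by rewrite ler_nat.
have [om omE] : exists om : R, om = (80 * r%:R)^-1 by exists (80 * r%:R)^-1.
rewrite -omE.
have o0 : 0 < om by rewrite omE invr_gt0; lra.
have o1 : om <= 1 by rewrite omE invf_le1; lra.
have [C0 C0E] : exists C0 : R, C0 = energy_const om by exists (energy_const om).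
have C0_ge1 : 1 <= C0.
  have i1 : 1 <= (om ^+ 2)^-1 by rewrite invf_ge1 ?exprn_ile1 ?(ltW o0) ?exprn_gt0.
  have : 0 <= 32 * (100 / om ^+ 2) ^+ 2 * om ^+ 2 by apply: mulr_ge0; [apply: mulr_ge0 => //; exact: sqr_ge0 | exact: sqr_ge0].
  by rewrite C0E /energy_const; lra.
(* One round of [r + 1] steps raises the energy exponent by at most [C1 * eta^2 * n^2]. *)
have [C1 C1E] : exists C1 : R, C1 = r.+1%:R * C0 by exists (r.+1%:R * C0).
have r1E : r.+1%:R = r%:R + 1 :> R by rewrite natr1.
have C1_ge1 : 1 <= C1 by rewrite C1E r1E; nra.
(* With this [L], [d] rounds gain [d * C1 * eta^2 * 2 n] in the exponent, at least [n] once
   [d * C1 * eta^2 >= 1/2]. *)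
have [L LE] : exists L : R, L = 40 * C1 by exists (40 * C1).
have L40 : 40 <= L by lra.
exists (r.+1%:R * (64 + 256 * L) * 200) => n N.
have [x xE] : exists x : R, x = n%:R by exists n%:R.
rewrite -xE => Dx.
have rL : 0 <= (r%:R - 2) * (L - 40) by rewrite mulr_ge0; lra.
(* [K * r * L <= n] amounts to [500 * n * eta <= om], the 80 coming from [om]; the energy bound asks
   for 400 in place of 500. *)
have [K K100 KE] : exists2 K : R, 100 <= K & K = 500 * 80 by exists (500 * 80) => //; lra.
have xrL : K * (r%:R * L) <= x by rewrite r1E in Dx; rewrite KE; lra.
have x0 : K <= x by nra.
have err_small : r.+1%:R * ((64 + 256 * L) / x) <= 15 / 1000.
  by rewrite mulrA ler_pdivrMr; [lra | lra].
have xL : 100 * L <= x by nra.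
have [eta etaE] : exists eta : R, eta = L / x ^+ 2 by exists (L / x ^+ 2).
have x2 : 0 < x ^+ 2 by rewrite exprn_gt0; lra.
have eta0 : 0 < eta by rewrite etaE divr_gt0 //; lra.
have xeta : x * eta = L / x by rewrite etaE; field; rewrite gt_eqF //; lra.
have xeta_le : x * eta <= 100^-1 by rewrite xeta ler_pdivrMr; lra.
have eta_le : eta <= x * eta by rewrite ler_peMl ?ltW //; lra.
have xeta_om : 500 * (x * eta) <= om.
  have -> : om = 500 / (K * r%:R) by rewrite omE KE; field; rewrite gt_eqF //; lra.
  rewrite xeta ler_pdivlMr; last by rewrite mulr_gt0; lra.
  have -> : 500 * (L / x) * (K * r%:R) = 500 * (K * (r%:R * L)) / x by ring.
  by rewrite ler_pdivrMr; lra.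
have eta_om : eta <= om by lra.
have x100 : 100 <= x by lra.
clear Dx rL KE xrL x0 K100 K.
have C1eta : C1 * eta ^+ 2 <= 2^-1.
  have h1 : C1 * eta <= x * eta by rewrite ler_wpM2r ?ltW //; lra.
  have h2 : C1 * eta * eta <= 1 * eta by rewrite ler_wpM2r ?ltW //; lra.
  by rewrite expr2 mulrA; lra.
have C1eta0 : 0 < C1 * eta ^+ 2 by rewrite mulr_gt0 ?exprn_gt0 //; lra.
(* The largest number of rounds with [d * C1 * eta^2 <= 1]; since [C1 * eta^2 <= 1/2], rounding down
   keeps this product at least [1/2]. *)
pose d := Num.truncn (C1 * eta ^+ 2)^-1.
have d_le : d%:R * (C1 * eta ^+ 2) <= 1.
  by rewrite -ler_pdivlMr // div1r truncn_le invr_ge0 ltW.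
have d_ge : 2^-1 <= d%:R * (C1 * eta ^+ 2).
  have : 1 < d.+1%:R * (C1 * eta ^+ 2) by rewrite -ltr_pdivrMr // div1r truncnS_gt.
  by rewrite -natr1 mulrDl; lra.
exists eta, (flatten (nseq d (enum 'I_r.+1))); split=> // A i An.
have sA : size (enum A) = n by rewrite -cardE.
have n21 : (21 <= n)%N by rewrite -(ler_nat R) -xE; lra.
have g_om : 4 * (100 / om ^+ 2) * eta * om = 400 * eta / om.
  by field; rewrite gt_eqF.
have M1 : 4 * eta <= 1 by lra.
have nM1 : x * (4 * eta) <= 1 by lra.
have M2 : 400 * eta / om <= 1 by rewrite ler_pdivrMr //; lra.
have nM2 : x * (400 * eta / om) <= 1 by rewrite mulrA ler_pdivrMr //; lra.
have := @expected_miss_ratio_le R 'I_N r eta om r2 omE eta0 eta_om i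
  (flatten (nseq d (enum 'I_r.+1))) (enum A) (enum_uniq _).
rewrite sA -xE g_om => /(_ n21 M1 nM1 M2 nM2) H; apply: le_trans H _.
rewrite [leRHS]mulr_natl [leRHS]mulr2n; apply: lerD; rewrite ler_expR.
  rewrite sum_rounds.
  have S : \sum_j rate eta i (enum A) j <= - (eta ^+ 3 * x ^+ 3 / 20).
    have := @sum_rate_le 'I_N eta i (enum A) eta0; rewrite sA -xE; apply.
      exact: leq_trans n21.
    by rewrite xeta (_ : 64 / x + 256 * (L / x) = (64 + 256 * L) / x); last by ring.
  apply: le_trans (ler_wpM2l (ler0n _ _) S) _.
  have -> : d%:R * - (eta ^+ 3 * x ^+ 3 / 20) =
      - (d%:R * (C1 * eta ^+ 2) * (2 * x)).
    rewrite (_ : eta ^+ 3 = eta ^+ 2 * (L / x ^+ 2)); last by rewrite exprSr etaE.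
    by rewrite LE; field; rewrite gt_eqF //; lra.
  by rewrite lerN2; nra.
have -> : size (flatten (nseq d (enum 'I_r.+1))) = (d * r.+1)%N.
  by rewrite size_flatten /shape map_nseq sumn_nseq size_enum_ord mulnC.
have -> : (eta ^+ 2 * x ^+ 2 * energy_const om) *+ (d * r.+1)%N =
    d%:R * (C1 * eta ^+ 2) * x ^+ 2.
  by rewrite -mulr_natl natrM C1E C0E; ring.
have : d%:R * (C1 * eta ^+ 2) * x ^+ 2 <= x ^+ 2 by rewrite ler_piMl // ltW.
have : 0 <= x * (x - 2) by rewrite mulr_ge0; lra.
lra.
Qed.

End Rounds.

(** * The first moment at the claimed size *)

Lemma expn_le_fact_expR (R : realType) (n : nat) : n%:R ^+ n <= n`!%:R * expR n%:R :> R.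
Proof.
case: n => [|n]; first by rewrite expr0 fact0 expR0 mulr1.
rewrite mulrC -ler_pdivrMr ?ltr0n ?fact_gt0 //.
have := @expR_ge1Dxn R n.+1%:R n (ler0n _ _).
by apply: le_trans; rewrite lerDr.
Qed.

Lemma bin_fact_le_expn (N n : nat) : ('C(N, n) * n`! <= N ^ n)%N.
Proof.
rewrite bin_ffact; elim: n => // n IH.
by rewrite ffactnSr expnSr leq_mul // leq_subr.
Qed.

Lemma bernoulli_quarter (R : realType) (n : nat) : 1 + n%:R / 4 <= (5 / 4) ^+ n :> R.
Proof.
elim: n => [|n IH]; first by rewrite mul0r addr0 expr0.
rewrite exprS -natr1; have := ler0n R n; lra.
Qed.

(** With [q = 1 + 1/r] and [s] its square root, the binomial coefficient times [q ^ (- binom(n, 2))]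
    is at most [(q s)^n]. The factor [exp (- n)] beats this, because [q s <= (3/2)^(3/2) < e]. *)
Lemma first_moment_lt1 (R : realType) (r n N : nat) : (2 <= r)%N ->
  8 * r.+1%:R <= n%:R :> R ->
  N%:R <= (expR 1)^-1 * (1 + 1 / r%:R) * n%:R * (1 + 1 / r%:R) `^ (n%:R / 2) :> R ->
  'C(N, n)%:R * r.+1%:R * (r%:R / r.+1%:R) ^+ 'C(n, 2) * (2 * expR (- n%:R)) < 1 :> R.
Proof.
move=> r2 nr HN.
have r2' : 2 <= r%:R :> R by rewrite ler_nat.
set q : R := 1 + 1 / r%:R in HN *.
have q1 : 1 < q by rewrite /q ltrDl divr_gt0 //; lra.
have q32 : q <= 3 / 2 by rewrite /q; have : 1 / r%:R <= 2^-1 :> R by [rewrite ler_pdivrMr; lra]; lra.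
set s := Num.sqrt q.
have s2 : s ^+ 2 = q by rewrite sqr_sqrtr //; lra.
have s0 : 0 < s by rewrite sqrtr_gt0; lra.
have qn : q `^ (n%:R / 2) = s ^+ n.
  by rewrite mulrC powRrM powR12_sqrt ?powR_mulrn ?sqrtr_ge0 //; lra.
have rq : r%:R / r.+1%:R = (s ^+ 2)^-1 :> R.
  by rewrite s2 /q -natr1; field; rewrite !gt_eqF //; lra.
have bin2E : ('C(n, 2) + 'C(n, 2) + n = n * n)%N.
  by elim: (n) => // m; rewrite binS bin1 => IH; lia.
have sbin : s ^+ (n * n) = (s ^+ 2) ^+ 'C(n, 2) * s ^+ n.
  by rewrite -exprM mul2n -addnn -exprD bin2E.
(* Here [(3/2)^3 < (15/8)^2] and [5/4 * 15/8 <= (5/4)^4 <= e]; the spare 5/4 absorbs the factor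
   [2 * r.+1] through [bernoulli_quarter]. *)
have e52 : 5 / 4 * (q * s) <= expR 1.
  have h1 : (1 + 4^-1) ^+ 4 <= expR 1 :> R.
    rewrite (_ : expR 1 = expR 4^-1 ^+ 4).
      by rewrite lerXn2r ?nnegrE ?expR_ge0 ?expR_ge1Dx; lra.
    by rewrite -expRM_natl mulfV ?pnatr_eq0.
  have h2 : q * s <= 15 / 8.
    rewrite leNgt; apply/negP => qs.
    have q3 : q * s * (q * s) = q * q * q by rewrite mulrACA -[s * s]expr2 s2.
    have q2 : q * q <= 9 / 4 by nra.
    have : q * q * q <= 27 / 8 by nra.
    have : 15 / 8 * (15 / 8) <= q * s * (q * s) by rewrite ler_pM ?ltW //; lra.
    lra.
  lra.
have s20 : 0 < (s ^+ 2) ^+ 'C(n, 2) by rewrite !exprn_gt0.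
have f0 : 0 < n`!%:R :> R by rewrite ltr0n fact_gt0.
have e0 : 0 < expR n%:R :> R := expR_gt0 _.
have eE : expR n%:R = expR 1 ^+ n :> R by rewrite -expRM_natl mulr1.
(* [binom N n <= N^n / n! <= (q n s^n / e)^n / n! <= q^n s^(n^2)],
   using [n^n <= n! e^n] *)
have B : 'C(N, n)%:R <= q ^+ n * s ^+ (n * n) :> R.
  rewrite -(ler_pM2r f0) -natrM.
  apply: (@le_trans _ _ (N%:R ^+ n)); first by rewrite -natrX ler_nat bin_fact_le_expn.
  rewrite qn in HN.
  apply: (@le_trans _ _ (((expR 1)^-1 * q * n%:R * s ^+ n) ^+ n)).
    by rewrite lerXn2r ?nnegrE // !mulr_ge0 ?invr_ge0 ?expR_ge0 ?exprn_ge0 ?ltW //; lra.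
  rewrite !exprMn -exprM exprVn -eE.
  have := expn_le_fact_expR R n; rewrite -ler_pdivrMr // => H.
  have -> : (expR n%:R)^-1 * q ^+ n * n%:R ^+ n * s ^+ (n * n) =
    q ^+ n * s ^+ (n * n) * (n%:R ^+ n / expR n%:R) by rewrite mulrC -!mulrA; ring.
  by rewrite ler_wpM2l // mulr_ge0 ?exprn_ge0 //; lra.
rewrite rq exprVn expRN eE.
apply: (@le_lt_trans _ _ ((q * s) ^+ n * (2 * r.+1%:R) / expR 1 ^+ n)).
  have -> : (q * s) ^+ n * (2 * r.+1%:R) / expR 1 ^+ n =
      q ^+ n * s ^+ (n * n) * r.+1%:R * ((s ^+ 2) ^+ 'C(n, 2))^-1 * (2 * (expR 1 ^+ n)^-1).
    by rewrite sbin exprMn; field; rewrite !gt_eqF // -eE.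
  apply: ler_wpM2r; first by rewrite -eE mulr_ge0 // invr_ge0 ltW.
  apply: ler_wpM2r; first by rewrite invr_ge0 ltW.
  exact: ler_wpM2r.
rewrite ltr_pdivrMr -?eE // mul1r eE.
have qs0 : 0 < q * s by rewrite mulr_gt0; lra.
apply: (@lt_le_trans _ _ ((5 / 4 * (q * s)) ^+ n)); last first.
  by rewrite lerXn2r ?nnegrE ?expR_ge0 //; lra.
rewrite [ltRHS]exprMn [ltLHS]mulrC ltr_pM2r ?exprn_gt0 //.
apply: lt_le_trans (bernoulli_quarter R n).
lra.
Qed.

Local Open Scope classical_set_scope.
Local Open Scope ring_scope.

Theorem theorem1p1 (R : realType) (r : nat) (hr : (2 <= r)%N) :
  exists o : nat -> R,
    (o n @[n --> \oo] --> (0 : R)) /\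
    (forall n : nat, (2 <= n)%N ->
      ((expR 1)^-1 * (1 + 1 / r%:R) + o n) * n%:R
        * (1 + 1 / r%:R) `^ (n%:R / 2)
      <= (ramsey_number n (ltnW hr))%:R).
Proof.
have [D HD] := exists_parameters R hr.
pose n0 := (maxn (Num.truncn D).+1 (8 * r.+1))%N.
(* Below [n0] the error term cancels the main constant, so the claimed bound is 0 there. *)
exists (fun n => if (n0 <= n)%N then 0 else - ((expR 1)^-1 * (1 + 1 / r%:R))).
split.
  apply: cvg_near_cst; near=> n.
  by rewrite ifT //; near: n; exact: nbhs_infty_ge.
move=> n _; case: (leqP n0 n) => [|_]; last by rewrite subrr !mul0r.
rewrite geq_max addr0 => /andP[nD nr]; rewrite leNgt; apply/negP => lt.
(* Now [N] is the Ramsey number itself, assumed below the bound; the first moment shows that this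
   very [N] does not arrow. *)
rewrite /ramsey_number in lt; case: ex_minnP lt => N arrN _ lt.
have Dn : D <= n%:R.
  by rewrite (le_trans (ltW (truncnS_gt D))) // ler_nat.
have [eta [js [eta0 eta_om HE]]] := HD n N Dn.
have := not_arrows_of_expected hr erefl eta0 eta_om HE.
rewrite arrN => H; suff : false by []; apply: H.
by apply: first_moment_lt1 => //; [rewrite -natrM ler_nat | exact: ltW].
Unshelve. all: by end_near.
Qed.
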